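(* Let $0<\mu<L$, $\Delta=L-\mu$, $\eta=\frac{L+\mu}{L-\mu}$, $z(\lambda)=\eta-\frac{2\lambda}{\Delta}$, and $N\ge1$. Let $b_0,\dots,b_{N-1}\in\mathbb R$, $a_0:=0$, $a_s>0$ for $s=1,\dots,N-1$, let $P_{-1}:=0$, $P_0:=1$, and $$P_{s+1}(z)=(z-b_s)P_s(z)-a_s^2P_{s-1}(z),\qquad s=0,\ldots,N-1.$$ Assume $P_s(\eta)>0$ for $s=0,\ldots,N$, and define $r_s(\lambda):=\dfrac{P_s(z(\lambda))}{P_s(\eta)}$. Consider the associated two-term method $$x_1=\frac1{P_1(\eta)}\Bigl[(\eta-b_0)x_0-\frac{2}{\Delta}\nabla f(x_0)\Bigr],$$ and, for $s=1,\ldots,N-1$, $$x_{s+1}=\frac{P_s(\eta)}{P_{s+1}(\eta)}\Bigl[(\eta-b_s)x_s-\frac{2}{\Delta}\nabla f(x_s)\Bigr]-a_s^2\frac{P_{s-1}(\eta)}{P_{s+1}(\eta)}x_{s-1}.$$ Then on every quadratic $f$ with Hessian $H$ satisfying $\mu I\preceq H\preceq LI$, the errors $e_s=x_s-x_\star$ satisfy $$e_s=r_s(H)e_0,\qquad s=0,\ldots,N.$$ In particular, if $P_N(z)=2^{1-N}T_N(z)$, then $e_N=p_N^\star(H)e_0$.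
   Context: $T_N$ is the Chebyshev polynomial of the first kind and $p_N^\star(\lambda)=T_N(z(\lambda))/T_N(\eta)$. A quadratic is $f(x)=f_\star+\frac12\langle H(x-x_\star),x-x_\star\rangle$ on a finite-dimensional real Hilbert space, with $H$ self-adjoint and minimizer $x_\star$. *)

(* Defs.v *)
From HB Require Import structures.
From mathcomp Require Import all_boot all_order all_algebra.
From mathcomp Require Import all_classical all_reals all_analysis.

Set Implicit Arguments.
Unset Strict Implicit.
Unset Printing Implicit Defensive.

Import Order.TTheory GRing.Theory Num.Theory.
Import numFieldNormedType.Exports.

Local Open Scope classical_set_scope.
Local Open Scope ring_scope.

(* Together with a dot product inducing the norm, this is a finite-dimensional
   real Hilbert space. *)
#[short(type="finNormedModType")]
HB.structure Definition FinNormedModule (R : realType) :=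
  {V of Vector R V & NormedModule R V}.

Section Hilbert.
Variables (R : realType) (V : finNormedModType R) (ip : {dot V for @idfun R}).

Definition induces_norm : Prop := forall v : V, `|v| ^+ 2 = ip v v.

Definition is_gradient (f : V -> R) (x g : V) : Prop :=
  differentiable f x /\ forall v : V, 'd f x v = ip g v.

(* 0 by convention where f is not differentiable *)
Definition grad (f : V -> R) (x : V) : V := xget 0 [set g | is_gradient f x g].

Definition self_adjoint (H : 'End(V)) : Prop :=
  forall u v : V, ip (H u) v = ip u (H v).

Definition loewner_le (A B : 'End(V)) : Prop :=
  forall v : V, ip (A v) v <= ip (B v) v.

Definition is_quadratic (f : V -> R) (H : 'End(V)) (xstar : V) (fstar : R)
    : Prop :=
  [/\ self_adjoint H,
      (forall x, f xstar <= f x)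
    & (forall x, f x = fstar + 2^-1 * ip (H (x - xstar)) (x - xstar))].

End Hilbert.

(* The library's ring structure on 'End(V), hence horner_alg, needs
   0 < dim V; this definition has no such restriction. *)
Definition lfun_horner (R : realType) (V : vectType R) (p : {poly R})
    (H : 'End(V)) : 'End(V) :=
  \sum_(i < size p) p`_i *: iter i (fun A : 'End(V) => (H \o A)%VF) \1%VF.

Fixpoint chebyshevT (R : realType) (n : nat) : {poly R} :=
  match n with
  | 0 => 1
  | n'.+1 => match n' with
             | 0 => 'X
             | m.+1 => 2 *: ('X * chebyshevT R n') - chebyshevT R m
             end
  end.

(* In the first step the inner match supplies P_{-1} = 0. *)
Fixpoint recP (R : realType) (a b : nat -> R) (n : nat) : {poly R} :=
  match n with
  | 0 => 1
  | s.+1 => ('X - (b s)%:P) * recP a b s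
            - (a s) ^+ 2 *: (match s with 0 => 0 | t.+1 => recP a b t end)
  end.

Section Method.
Variables (R : realType) (mu L : R).

Definition Delta : R := L - mu.
Definition cheb_eta : R := (L + mu) / (L - mu).
Definition cheb_z : {poly R} := cheb_eta%:P - (2 / Delta) *: 'X.

(* T_N(z(lambda)) / T_N(eta) as a polynomial in lambda *)
Definition cheb_pstar (N : nat) : {poly R} :=
  (chebyshevT R N).[cheb_eta]^-1 *: (chebyshevT R N \Po cheb_z).

Variables (a b : nat -> R).

Definition resid (s : nat) : {poly R} :=
  (recP a b s).[cheb_eta]^-1 *: (recP a b s \Po cheb_z).

Definition two_term_method (V : finNormedModType R)
    (ip : {dot V for @idfun R}) (N : nat) (f : V -> R) (x : nat -> V) : Prop :=
  let Pe s := (recP a b s).[cheb_eta] in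
  x 1 = (Pe 1)^-1 *:
          ((cheb_eta - b 0) *: x 0 - (2 / Delta) *: grad ip f (x 0)) /\
  forall s : nat, (1 <= s < N)%N ->
    x s.+1 = (Pe s / Pe s.+1) *:
               ((cheb_eta - b s) *: x s - (2 / Delta) *: grad ip f (x s))
             - ((a s) ^+ 2 * (Pe s.-1 / Pe s.+1)) *: x s.-1.

End Method.

(* Main.v *)
(** On a quadratic, [grad f x = H (x - xstar)], so multiplying step [s] of the
    method by [P_{s+1}(eta)] shows that [P_s(eta) e_s] satisfies the recurrence
    of [P_s(z(H)) e_0], with [2/Delta H] coming from [eta I - z(H)]; both
    sequences have the same first two terms. *)

Require Import Defs.
From HB Require Import structures.
From mathcomp Require Import all_boot all_order all_algebra.
From mathcomp Require Import all_classical all_reals all_analysis.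
From mathcomp Require Import ring lra.

Import Order.TTheory GRing.Theory Num.Theory.
Import numFieldNormedType.Exports.
Local Open Scope ring_scope.

Section InnerProduct.
Variables (R : realType) (V : finNormedModType R) (ip : {dot V for @idfun R}).

Lemma ipC (u v : V) : ip u v = ip v u.
Proof. by rewrite [LHS]hermC expr0 mul1r. Qed.

Lemma ipDl (u v w : V) : ip (u + v) w = ip u w + ip v w.
Proof. exact: linearDl. Qed.

Lemma ipZl (c : R) (u w : V) : ip (c *: u) w = c * ip u w.
Proof. exact: linearZl_LR. Qed.

Lemma ipDr (u v w : V) : ip w (u + v) = ip w u + ip w v.
Proof. by rewrite ipC ipDl !(ipC w). Qed.

Lemma ipZr (c : R) (u w : V) : ip w (c *: u) = c * ip w u.
Proof. by rewrite ipC ipZl (ipC w). Qed.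

(* [ip g] is canonically linear for the scaling [idfun \; *%R]; the
   differential needs it as a linear map for [*:%R]. *)
Definition ip_left (g v : V) : R := ip g v.

Fact ip_left_linear (g : V) : linear (ip_left g).
Proof. by move=> c u v; rewrite /ip_left ipDr ipZr. Qed.

HB.instance Definition _ (g : V) :=
  GRing.isLinear.Build R V R *:%R (ip_left g) (ip_left_linear g).

Hypothesis hip : induces_norm ip.

(** For e = 1 and e = -1, the squared norm of |v| u + e |u| v expands to 2 |u| |v| (|u| |v| + e
    [ip u v]). It is nonnegative, and dividing by the positive factor 2 |u| |v| gives both
    bounds. *)
Lemma ip_cauchy_schwarz (u v : V) : `|ip u v| <= `|u| * `|v|.
Proof.
have [->|u0] := eqVneq u 0; first by rewrite linear0l !normr0 mul0r.
have [->|v0] := eqVneq v 0; first by rewrite ipC linear0l !normr0 mulr0.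
have up : 0 < `|u| * `|v| by rewrite mulr_gt0 ?normr_gt0.
have E (e : R) : e ^+ 2 = 1 -> 0 <= `|u| * `|v| + e * ip u v.
  move=> e2; rewrite -(pmulr_rge0 _ up) -(pmulr_rge0 _ (ltr0Sn R 1)).
  have := sqr_ge0 `| `|v| *: u + (e * `|u|) *: v|.
  rewrite hip ipDl !ipDr !ipZl !ipZr -!hip (ipC v u).
  have -> : e * `|u| * (e * `|u| * `|v| ^+ 2) = e ^+ 2 * (`|u| ^+ 2 * `|v| ^+ 2).
    by ring.
  by rewrite e2; congr (0 <= _); ring.
have := E 1; have := E (-1); rewrite sqrrN expr1n mul1r mulN1r.
by move=> /(_ erefl) + /(_ erefl); rewrite ler_norml; lra.
Qed.

Lemma ip_left_continuous (g : V) : continuous (ip_left g).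
Proof.
apply/linear_bounded_continuous/linear_boundedP.
near=> r => v; apply: le_trans (ip_cauchy_schwarz g v) _.
apply: ler_wpM2r => //.
Unshelve. all: by end_near. Qed.

(** Testing at v = g - g' gives |g - g'|^2 = 0. This makes gradients unique, so the choice made by
    [xget] in [grad] is determined. *)
Lemma ip_inj (g g' : V) : (forall v, ip g v = ip g' v) -> g = g'.
Proof.
move=> E; apply/eqP; rewrite -subr_eq0 -normr_eq0 -sqrf_eq0 hip.
by rewrite -[- g']scaleN1r ipDl ipZl E mulN1r subrr.
Qed.

Lemma is_gradient_expansion (f : V -> R) (x g : V) (C : R) :
  (forall h, `|f (h + x) - f x - ip g h| <= C * `|h| ^+ 2) ->
  is_gradient ip f x g.
Proof.
move=> fC.
have fE : f \o shift x = cst (f x) + ip_left g +o_ (0 : V) id.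
  apply/eqaddoP => e e0; near=> h.
  rewrite /= !fctE /= opprD addrA; apply: le_trans (fC h) _.
  rewrite expr2 mulrA; apply: ler_wpM2r => //.
  (* [C] may be zero or negative; |C| + 1 is positive, so |h| < e / (|C| + 1) is a neighbourhood of
     0 on which the remainder is at most e |h|. *)
  apply: (@le_trans _ _ ((`|C| + 1) * `|h|)).
    by apply: ler_wpM2r => //; have := ler_norm C; lra.
  rewrite -ler_pdivlMl; last by have := normr_ge0 C; lra.
  apply/ltW; near: h; apply: nbhs0_lt.
  by rewrite mulr_gt0 // invr_gt0 ltr_pwDr.
have dE := diff_unique (ip_left_continuous g) fE.
split; last by move=> v; rewrite dE.
by apply/diff_locallyP; rewrite dE; split=> //; exact: ip_left_continuous.
Unshelve. all: by end_near. Qed.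

Lemma gradE (f : V -> R) (x g : V) : is_gradient ip f x g -> grad ip f x = g.
Proof.
move=> fg; rewrite /grad; case: xgetP => [g' _ [_ fg']|/(_ g)//].
by apply: ip_inj => v; rewrite -fg' fg.2.
Qed.

(* The two Loewner bounds make the second-order remainder [O(|h|^2)], so no
   continuity of [H] is needed. *)
Lemma grad_quadratic (mu L : R) (f : V -> R) (H : 'End(V)) (xstar : V)
    (fstar : R) (x : V) :
  is_quadratic ip f H xstar fstar ->
  loewner_le ip (mu *: \1%VF) H -> loewner_le ip H (L *: \1%VF) ->
  grad ip f x = H (x - xstar).
Proof.
move=> [Hsa _ fE] Hmu HL; apply: gradE.
apply: (@is_gradient_expansion _ _ _ (`|mu| + `|L|)) => h.
(* With e = x - xstar, the cross terms [ip (H h) e] and [ip (H e) h] agree by self-adjointness and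
   symmetry; their half-sum is exactly the subtracted linear term. *)
have -> : f (h + x) - f x - ip (H (x - xstar)) h = 2^-1 * ip (H h) h.
  rewrite !fE -[h + x - _]addrA; move: (x - xstar) => e.
  by rewrite (linearD H) ipDl !ipDr (Hsa h e) (ipC h); lra.
move: (Hmu h) (HL h); rewrite !scale_lfunE !id_lfunE !ipZl -!hip => mh Lh.
have h2 := sqr_ge0 `|h|.
have muh : - `|mu| * `|h| ^+ 2 <= mu * `|h| ^+ 2.
  by apply: ler_wpM2r => //; rewrite lerNl -normrN ler_norm.
have Lh' : L * `|h| ^+ 2 <= `|L| * `|h| ^+ 2.
  by apply: ler_wpM2r => //; rewrite ler_norm.
have muh0 : 0 <= `|mu| * `|h| ^+ 2 by rewrite mulr_ge0.
have Lh0 : 0 <= `|L| * `|h| ^+ 2 by rewrite mulr_ge0.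
by rewrite ler_norml; lra.
Qed.

End InnerProduct.

Section PolynomialCalculus.
Variables (R : realType) (V : vectType R) (H : 'End(V)).

(** Padding with zero coefficients puts polynomials of different sizes over one common index range,
    where they can be added termwise. *)
Lemma lfun_horner_iter (p : {poly R}) (n : nat) (v : V) : (size p <= n)%N ->
  lfun_horner p H v = \sum_(i < n) p`_i *: iter i H v.
Proof.
move=> pn; rewrite sum_lfunE (eq_bigr (fun i : 'I__ => p`_i *: iter i H v)).
  rewrite (big_ord_widen _ (fun i => p`_i *: iter i H v) pn) big_mkcond /=.
  apply: eq_bigr => i _; case: ltnP => // /(nth_default 0) ->.
  by rewrite scale0r.
move=> i _; rewrite scale_lfunE; congr (_ *: _).
by elim: (nat_of_ord i) => [|k IH] /=; rewrite ?id_lfunE // comp_lfunE IH.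
Qed.

Lemma lfun_horner1 (v : V) : lfun_horner 1 H v = v.
Proof. by rewrite (lfun_horner_iter _ 1) ?size_poly1 // big_ord1 coef1 scale1r. Qed.

Lemma lfun_hornerD (p q : {poly R}) (v : V) :
  lfun_horner (p + q) H v = lfun_horner p H v + lfun_horner q H v.
Proof.
pose n := maxn (size p) (size q).
rewrite !(@lfun_horner_iter _ n) ?leq_maxl ?leq_maxr ?size_polyD //.
by rewrite -big_split; apply: eq_bigr => i _; rewrite coefD scalerDl.
Qed.

Lemma lfun_hornerZ (c : R) (p : {poly R}) (v : V) :
  lfun_horner (c *: p) H v = c *: lfun_horner p H v.
Proof.
rewrite !(@lfun_horner_iter _ (size p)) ?size_scale_leq // scaler_sumr.
by apply: eq_bigr => i _; rewrite coefZ scalerA.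
Qed.

Lemma lfun_hornerXM (p : {poly R}) (v : V) :
  lfun_horner ('X * p) H v = H (lfun_horner p H v).
Proof.
rewrite (@lfun_horner_iter _ (size p).+1); last first.
  by rewrite (leq_trans (size_polyMleq _ _)) ?size_polyX.
rewrite (@lfun_horner_iter p (size p)) // big_ord_recl coefXM scale0r add0r.
by rewrite linear_sum; apply: eq_bigr => i _; rewrite linearZ coefXM.
Qed.

End PolynomialCalculus.

Section Recurrence.
Variables (R : realType) (mu L : R) (a b : nat -> R).
Variables (V : vectType R) (H : 'End(V)) (v : V).

Let Q s := lfun_horner (recP a b s \Po cheb_z mu L) H v.

Lemma lfun_horner_recP1 :
  Q 1 = (cheb_eta mu L - b 0%N) *: v - (2 / Delta mu L) *: H v.
Proof.
(* [scaler0] removes the [a 0] term, whose polynomial factor is P_{-1} = 0. *)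
rewrite /Q /= scaler0 subr0 mulr1 comp_polyB comp_polyX comp_polyC /cheb_z.
rewrite (_ : _ - _ = (cheb_eta mu L - b 0%N) *: 1 + (- (2 / Delta mu L)) *: ('X * 1)).
  by rewrite lfun_hornerD !lfun_hornerZ lfun_hornerXM lfun_horner1 scaleNr.
by rewrite -!mul_polyC polyCN polyCB; ring.
Qed.

Lemma lfun_horner_recPSS (s : nat) :
  Q s.+2 = (cheb_eta mu L - b s.+1) *: Q s.+1 - (2 / Delta mu L) *: H (Q s.+1)
           - a s.+1 ^+ 2 *: Q s.
Proof.
rewrite {1}/Q.
have -> : recP a b s.+2 = ('X - (b s.+1)%:P) * recP a b s.+1
                          - a s.+1 ^+ 2 *: recP a b s by [].
rewrite comp_polyB comp_polyM comp_polyB comp_polyX comp_polyC comp_polyZ.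
set p := _ \Po _; set q := _ \Po _.
(* Since z(lambda) - b_{s+1} is affine in lambda, its product with [p] is a combination of [p] and
   ['X * p], so additivity, scaling and [lfun_hornerXM] suffice. *)
rewrite (_ : _ - _ = (cheb_eta mu L - b s.+1) *: p
    + (- (2 / Delta mu L)) *: ('X * p) + (- a s.+1 ^+ 2) *: q).
  by rewrite !lfun_hornerD !lfun_hornerZ lfun_hornerXM !scaleNr.
by rewrite /cheb_z -!mul_polyC !polyCN polyCB; ring.
Qed.

End Recurrence.

Theorem theorem4p1 (R : realType) (mu L : R) (N : nat) (a b : nat -> R)
    (hmu : 0 < mu) (hmuL : mu < L) (hN : (1 <= N)%N)
    (ha0 : a 0%N = 0)
    (ha : forall s : nat, (1 <= s < N)%N -> 0 < a s)
    (hP : forall s : nat, (s <= N)%N -> 0 < (recP a b s).[cheb_eta mu L])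
    (V : finNormedModType R) (ip : {dot V for @idfun R})
    (hip : induces_norm ip)
    (f : V -> R) (H : 'End(V)) (xstar : V) (fstar : R)
    (hf : is_quadratic ip f H xstar fstar)
    (hHmu : loewner_le ip (mu *: \1%VF) H)
    (hHL : loewner_le ip H (L *: \1%VF))
    (x : nat -> V) (hx : two_term_method mu L a b ip N f x) :
  (forall s : nat, (s <= N)%N ->
     x s - xstar = lfun_horner (resid mu L a b s) H (x 0%N - xstar)) /\
  (recP a b N = (2 : R) ^ (1 - N%:Z) *: chebyshevT R N ->
     x N - xstar = lfun_horner (cheb_pstar mu L N) H (x 0%N - xstar)).
Proof.
have Gr y : grad ip f y = H (y - xstar) by exact: grad_quadratic hf hHmu hHL.
case: hx; set Pe := fun s => (recP a b s).[cheb_eta mu L].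
set eta := cheb_eta mu L in Pe *; set d := 2 / Delta mu L => x1 xS.
pose Q s := lfun_horner (recP a b s \Po cheb_z mu L) H (x 0%N - xstar).
have Pe0 s : (s <= N)%N -> Pe s != 0 by move=> sN; rewrite gt_eqF ?hP.
have Q0 : Q 0%N = x 0%N - xstar by rewrite /Q /= comp_polyC lfun_horner1.
have PeS s : Pe s.+2 = (eta - b s.+1) * Pe s.+1 - a s.+1 ^+ 2 * Pe s.
  by rewrite /Pe [recP a b s.+2]/= !hornerE.
have Pe1 : Pe 1 = eta - b 0%N by rewrite /Pe /= !hornerE; ring.
have e0 : Pe 0%N *: (x 0%N - xstar) = Q 0%N by rewrite Q0 /Pe /= hornerC scale1r.
have e1 : Pe 1 *: (x 1 - xstar) = Q 1.
  rewrite x1 /Q lfun_horner_recP1 scalerBr scalerA divff ?Pe0 // scale1r Gr.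
  by rewrite -/(Pe 1) {1}Pe1 scalerBr addrAC.
(* The recurrence has order two, so the induction carries two consecutive indices. *)
have eQ s : (s.+1 <= N)%N ->
    Pe s *: (x s - xstar) = Q s /\ Pe s.+1 *: (x s.+1 - xstar) = Q s.+1.
  elim: s => [//|s IH] sN; have [es es1] := IH (ltnW sN); split=> //.
  rewrite /Q lfun_horner_recPSS -/eta -/d -/(Q s) -/(Q s.+1) -es -es1.
  rewrite xS // Gr /= -/(Pe s.+2) -/(Pe s.+1) -/(Pe s) [H (_ *: _)]linearZ /=.
  (* The step for [x] has no [xstar]; expanding its coefficient [Pe s.+2] by the recurrence at eta
     splits it into the [xstar] parts of the two previous errors. *)
  have := Pe0 _ sN; move: (eta - b s.+1) (PeS s) => c PeSS Pe_neq0.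
  rewrite scalerBr [X in X - _]scalerBr !scalerA.
  rewrite (mulrC (Pe s.+2)) mulrCA (mulrC (Pe s.+2)) !divfK // PeSS.
  rewrite scalerBl !scalerBr !scalerA !(mulrC (Pe s.+1)).
  (* Both sides are sums of the same five vectors; only their order and grouping differ. *)
  by rewrite !opprB [LHS](AC (3*2) ((1*5*2)*(4*3))).
have eR s : (s <= N)%N ->
    x s - xstar = lfun_horner (resid mu L a b s) H (x 0%N - xstar).
  move=> sN; rewrite /resid lfun_hornerZ -/(Q s) -/(Pe s).
  have -> : Q s = Pe s *: (x s - xstar).
    by case: s sN => [//|s] sN; have [] := eQ s sN.
  by rewrite scalerA mulVf ?Pe0 // scale1r.
(* The nonzero scalar 2^(1-N) appears in both P_N(z) and P_N(eta), so it cancels in their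
   quotient. *)
split=> // hT; rewrite eR //; congr (lfun_horner _ _ _).
rewrite /resid /cheb_pstar hT hornerZ comp_polyZ scalerA invfM.
by rewrite mulrAC mulVf ?mul1r // expfz_neq0 // pnatr_eq0.
Qed.
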